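(* For every integer $n\geq 0$ and every $x\in\mathbb{C}$, $$\sum_{k=0}^{\lfloor n/2\rfloor}\binom{n}{2k}(4^k-1)\bigl(144x^2(9x^2-1)\bigr)^k B_{2k}\,C_{2(n-2k)}(x) = 6nx(9x^2-1)B^*_{2(n-1)}(x).$$
   Context: $B_n$ denotes the $n$-th Bernoulli number, defined by $\sum_{n\ge0}B_n\frac{z^n}{n!}=\frac{z}{e^z-1}$. The balancing polynomials are defined by $B^*_0(x)=0$, $B^*_1(x)=1$, $B^*_n(x)=6xB^*_{n-1}(x)-B^*_{n-2}(x)$ for $n\ge2$. The Lucas-balancing polynomials are defined by $C_0(x)=1$, $C_1(x)=3x$, $C_n(x)=6xC_{n-1}(x)-C_{n-2}(x)$ for $n\ge2$. For $n=0$ the right-hand side, which carries the factor $n$, is interpreted as $0$. *)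

(* Defs.v *)
From HB Require Import structures.
From mathcomp Require Import all_boot all_order all_algebra.
Set Implicit Arguments.
Unset Strict Implicit.
Unset Printing Implicit Defensive.
Import GRing.Theory Num.Theory.
Local Open Scope ring_scope.

(* A formal power series over K is its sequence of coefficients [nat -> K]. *)

Definition fps_mul (K : fieldType) (a b : nat -> K) (n : nat) : K :=
  \sum_(i < n.+1) a i * b (n - i)%N.

(* The first n coefficients of 1/a, for a with nonzero constant term, obtained
   by solving (1/a) * a = 1 one coefficient at a time. *)
Fixpoint fps_inv_seq (K : fieldType) (a : nat -> K) (n : nat) : seq K :=
  if n is m.+1 then
    let s := fps_inv_seq a m in
    rcons s (((m == 0)%N%:R - \sum_(i < m) s`_i * a (m - i)%N) / a 0%N)
  else [::].

Definition fps_inv (K : fieldType) (a : nat -> K) (n : nat) : K :=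
  (fps_inv_seq a n.+1)`_n.

Definition fps_exp (n : nat) : rat := (n`!%:R)^-1.

(* e^z - 1 has no constant term, so z / (e^z - 1) is the inverse of the shifted
   series (e^z - 1) / z, whose n-th coefficient is the (n+1)-st one of e^z. *)
Definition bernoulli_egf : nat -> rat := fps_inv (fun n => fps_exp n.+1).

Definition bernoulli (n : nat) : rat := n`!%:R * bernoulli_egf n.

Lemma size_fps_inv_seq (K : fieldType) (a : nat -> K) n :
  size (fps_inv_seq a n) = n.
Proof. by elim: n => //= n IHn; rewrite size_rcons IHn. Qed.

Lemma nth_fps_inv_seq (K : fieldType) (a : nat -> K) n i :
  (i < n)%N -> (fps_inv_seq a n)`_i = fps_inv a i.
Proof.
elim: n => // n IHn; rewrite ltnS leq_eqVlt => /predU1P[-> // | lt_in].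
by rewrite /= nth_rcons size_fps_inv_seq lt_in IHn.
Qed.

Lemma fps_invE (K : fieldType) (a : nat -> K) n :
  fps_inv a n =
  ((n == 0)%N%:R - \sum_(i < n) fps_inv a i * a (n - i)%N) / a 0%N.
Proof.
rewrite {1}/fps_inv /= nth_rcons size_fps_inv_seq ltnn eqxx.
by congr ((_ - _) / _); apply: eq_bigr => i _; rewrite nth_fps_inv_seq.
Qed.

Lemma fps_invP (K : fieldType) (a b : nat -> K) : a 0%N != 0 ->
  (forall n, fps_mul b a n = (n == 0)%N%:R) <-> b =1 fps_inv a.
Proof.
move=> a0; split=> [ab n | ab n]; last first.
  rewrite /fps_mul big_ord_recr /= subnn ab [in X in _ + X]fps_invE divfK //.
  by rewrite addrC -[RHS]addr0 -addrA; congr (_ + _); apply/eqP;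
     rewrite addrC subr_eq0; apply/eqP/eq_bigr => i _; rewrite ab.
elim/ltn_ind: n => n IHn; rewrite fps_invE -ab /fps_mul big_ord_recr /= subnn.
rewrite addrC (eq_bigr (fun i : 'I_n => fps_inv a i * a (n - i)%N)).
  by rewrite addrK mulfK.
by move=> i _; rewrite IHn.
Qed.

(* The defining identity (\sum_n B_n z^n / n!) * (e^z - 1) = z, which determines
   the sequence. *)
Lemma bernoulliP (B : nat -> rat) :
  (forall n, fps_mul (fun m => B m / m`!%:R)
                     (fun m => fps_exp m - (m == 0)%N%:R) n = (n == 1)%N%:R)
  <-> B =1 bernoulli.
Proof.
have factn0 n : n`!%:R != 0 :> rat by rewrite pnatr_eq0 -lt0n fact_gt0.
pose b m := B m / m`!%:R; pose a n := fps_exp n.+1.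
pose c m : rat := fps_exp m - (m == 0)%N%:R.
have c0 : c 0%N = 0 by rewrite /c /fps_exp fact0 invr1 subrr.
have cS n : c n.+1 = a n by rewrite /c subr0.
have mul0 : fps_mul b c 0 = 0 by rewrite /fps_mul big_ord1 c0 mulr0.
have mulS n : fps_mul b c n.+1 = fps_mul b a n.
  rewrite /fps_mul big_ord_recr /= subnn c0 mulr0 addr0.
  by apply: eq_bigr => i _; rewrite subSn ?cS // -ltnS.
have a0 : a 0%N != 0 by rewrite /a /fps_exp invr_eq0.
have [inv1 inv2] := fps_invP b a0.
split=> [eqB n | eqB].
  rewrite /bernoulli /bernoulli_egf -[fps_inv _ n]inv1; last first.
    by move=> m; rewrite -mulS; apply: eqB.
  by rewrite /b mulrC divfK.
have eqb : b =1 fps_inv a.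
  by move=> n; rewrite /b eqB /bernoulli mulrC mulKf.
by case=> [|n]; [exact: mul0 | rewrite mulS inv2].
Qed.

Fixpoint balancing (K : nzRingType) (n : nat) : {poly K} :=
  match n with
  | 0 => 0
  | 1 => 1
  | (m.+1 as n1).+1 => 6%:R *: 'X * balancing K n1 - balancing K m
  end.

Fixpoint lucas_balancing (K : nzRingType) (n : nat) : {poly K} :=
  match n with
  | 0 => 1
  | 1 => 3%:R *: 'X
  | (m.+1 as n1).+1 => 6%:R *: 'X * lucas_balancing K n1 - lucas_balancing K m
  end.

(* Main.v *)
(** Let L be the linear functional on polynomials with L(X^i) = B_i.  The
    recurrence of the Bernoulli numbers says L(p(X+1)) - L(p) = p'(0), and this
    property determines L.  By this uniqueness L(p(-1-X)) = L(p), which makes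
    B_i vanish for odd i > 1, and L(p(2X)) + L(p(2X+1)) = 2 L(p).  Put
    s^2 = 9x^2-1, a = (3x+s)^2, b = (3x-s)^2 and d = a - b = 12xs, so that
    C_{2m}(x) = (a^m + b^m)/2, 2s B*_{2m}(x) = a^m - b^m and
    d^2 = 144x^2(9x^2-1).  Completed with the i = 1 term, twice the left-hand
    side is the sum over y = a, b of L((y+2dX)^n) - L((y+dX)^n).  As a = b + d,
    the duplication formula reduces it to L((b+dX)^n) - L((a+dX)^n), which is
    -n d b^(n-1). *)
Require Import Defs.
From HB Require Import structures.
From mathcomp Require Import all_boot all_order all_algebra.
From mathcomp Require Import reals complex.
From mathcomp Require Import ring.
Set Implicit Arguments.
Unset Strict Implicit.
Unset Printing Implicit Defensive.
Import GRing.Theory Num.Theory.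
Local Open Scope ring_scope.
Local Open Scope complex_scope.

(** This is n! times the coefficient of z^n in the defining identity; the i = n term drops out
    because e^z - 1 has no constant term. *)
Lemma sum_bernoulli n :
  \sum_(i < n) 'C(n, i)%:R * bernoulli i = (n == 1)%N%:R.
Proof.
have /(_ n) := (bernoulliP bernoulli).2 (frefl _).
rewrite /fps_mul big_ord_recr /= subnn /fps_exp fact0 invr1 subrr mulr0 addr0.
move=> sumE.
transitivity (n`!%:R * (n == 1)%N%:R : rat); last first.
  by case: n {sumE} => [|[|n]] //=; rewrite !mulr0.
rewrite -sumE mulr_sumr; apply: eq_bigr => i _.
have lt_in := ltn_ord i.
rewrite subn_eq0 leqNgt lt_in /= subr0 -(bin_fact (ltnW lt_in)) !natrM.
have f0 m : m`!%:R != 0 :> rat by rewrite pnatr_eq0 -lt0n fact_gt0.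
by field; rewrite !f0.
Qed.

Lemma sum_even (V : nmodType) (F : nat -> V) n :
  (forall i, odd i -> F i = 0) ->
  \sum_(i < n.+1) F i = \sum_(0 <= k < (n %/ 2).+1) F (2 * k)%N.
Proof.
move=> F0; rewrite divn2; elim: n => [|n IHn].
  by rewrite big_ord1 big_nat1.
rewrite big_ord_recr /= IHn uphalf_half.
have [odd_n|even_n] := boolP (odd n); last by rewrite F0 ?addr0.
rewrite add1n [RHS]big_nat_recr //=; congr (_ + F _).
by rewrite mulnS mul2n -[in LHS](odd_double_half n) odd_n.
Qed.

(** * Linear functionals on polynomials *)

Section Umbral.
Variable K : fieldType.

(** [K^o] is the field as a module over itself, so that the functional sending X^i to b_i can be a
    linear map. *)
Definition umbral (b : nat -> K) (p : {poly K}) : K^o :=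
  \sum_(i < size p) p`_i * b i.

Lemma umbral_widen b N (p : {poly K}) : (size p <= N)%N ->
  umbral b p = \sum_(i < N) p`_i * b i.
Proof.
move=> le_pN; rewrite /umbral (big_ord_widen N (fun i => p`_i * b i)) //.
rewrite big_mkcond; apply: eq_bigr => i _ /=.
by case: ltnP => // le_pi; rewrite nth_default ?mul0r.
Qed.

Lemma umbral_is_linear b : linear (umbral b).
Proof.
move=> c p q; set N := maxn (size p) (size q).
have le_N : (size (c *: p + q)%R <= N)%N.
  by rewrite (leq_trans (size_polyD _ _)) // geq_max !leq_max leqnn orbT
     size_scale_leq.
rewrite !(@umbral_widen b N) ?leq_maxl ?leq_maxr // scaler_sumr -big_split /=.
by apply: eq_bigr => i _; rewrite coefD coefZ mulrDl -mulrA.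
Qed.

HB.instance Definition _ b :=
  GRing.isLinear.Build K {poly K} K^o *:%R (umbral b) (umbral_is_linear b).

Lemma umbralXn b n : umbral b 'X^n = b n.
Proof.
rewrite /umbral size_polyXn big_ord_recr /= coefXn eqxx mul1r big1 ?add0r //.
by move=> i _; rewrite coefXn ltn_eqF ?ltn_ord // mul0r.
Qed.

Definition affine (u v : K) : {poly K} := u%:P + v *: 'X.

Lemma affine_id : affine 0 1 = 'X.
Proof. by rewrite /affine scale1r add0r. Qed.

Lemma comp_affine (u v c d : K) :
  affine u v \Po affine c d = affine (u + v * c) (v * d).
Proof.
rewrite /affine linearD linearZ /= comp_polyC comp_polyX scalerDr scalerA.
by rewrite -mul_polyC -polyCM addrA -polyCD.
Qed.

Lemma umbral_binomial b n (y d : K) :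
  umbral b (affine y d ^+ n) =
  \sum_(i < n.+1) 'C(n, i)%:R * d ^+ i * b i * y ^+ (n - i).
Proof.
rewrite exprDn linear_sum; apply: eq_bigr => i _.
rewrite exprZn -polyC_exp mul_polyC scalerA linearMn linearZ /= umbralXn.
by rewrite -mulr_natl /GRing.scale /=; ring.
Qed.

Lemma linear_poly_eq0 (h : {linear {poly K} -> K^o}) :
  (forall n, h 'X^n = 0) -> forall p, h p = 0.
Proof.
move=> h0 p; rewrite -[p]coefK poly_def linear_sum big1 // => i _.
by rewrite linearZ /= h0 scaler0.
Qed.

(** Invariance at X^(n+1) says that (n+1) h(X^n) plus multiples of h at lower powers is 0, which
    feeds a strong induction. *)
Lemma shift_invariant_eq0 (h : {linear {poly K} -> K^o}) :
  [pchar K] =i pred0 ->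
  (forall p, h (p \Po affine 1 1) = h p) -> forall p, h p = 0.
Proof.
move=> /pcharf0P char0 h_inv; apply: linear_poly_eq0; elim/ltn_ind=> n IHn.
have := h_inv 'X^(n.+1).
rewrite comp_Xn_poly /affine scale1r polyC1 exprDn linear_sum.
rewrite 2!big_ord_recr /= big1 => [|i _].
  rewrite !expr1n !mul1r binn binSn add0r mulr1n.
  move/(canRL (addrK _)); rewrite subrr linearMn /= -mulr_natl => /eqP.
  by rewrite mulf_eq0 char0 => /eqP.
by rewrite expr1n mul1r linearMn /= IHn ?ltn_ord // mul0rn.
Qed.

End Umbral.

(** * The Bernoulli functional *)

Section BernoulliFunctional.
Variable K : numFieldType.

Local Notation bern := (fun i => ratr (bernoulli i) : K).
Local Notation L := (umbral bern).

Lemma bernoulli_shift p : L (p \Po affine 1 1) - L p = p^`().[0].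
Proof.
apply/eqP; rewrite -subr_eq0; apply/eqP.
pose h : {linear {poly K} -> K^o} :=
  (L \o comp_poly (affine 1 1)) \- L \- (horner_eval 0 \o (@deriv K)).
apply: (@linear_poly_eq0 K h) => n.
rewrite /h /= comp_Xn_poly umbralXn /horner_eval derivXn.
rewrite umbral_binomial big_ord_recr /= binn subnn !expr1n !mul1r mulr1 addrK.
have -> : \sum_(i < n) 'C(n, i)%:R * 1 ^+ i * bern i * 1 ^+ (n - i)
   = ratr (\sum_(i < n) 'C(n, i)%:R * bernoulli i) :> K.
  rewrite rmorph_sum; apply: eq_bigr => i _.
  by rewrite rmorphM /= ratr_nat !expr1n !mulr1.
rewrite sum_bernoulli ratr_nat hornerMn hornerXn.
by case: n => [|[|n]] //=; rewrite ?expr0n ?mul0rn ?subrr.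
Qed.

Lemma bernoulli_affine_shift p (u v : K) :
  L (p \Po affine (u + v) v) = L (p \Po affine u v) + v * p^`().[u].
Proof.
have := bernoulli_shift (p \Po affine u v).
rewrite -comp_polyA comp_affine mulr1 deriv_comp hornerM horner_comp.
rewrite !linearD linearZ /= derivC derivX /affine !hornerE.
by rewrite /= mulr1 mulrC => <-; rewrite [RHS]addrC subrK.
Qed.

(** Both L(p(-X)) - L(p(-1-X)) and L(p(X+1)) - L(p) equal p'(0), so the difference of the two sides
    is shift-invariant. *)
Lemma bernoulli_reflection p : L (p \Po affine (-1) (-1)) = L p.
Proof.
apply/eqP; rewrite -subr_eq0; apply/eqP.
pose h : {linear {poly K} -> K^o} := (L \o comp_poly (affine (-1) (-1))) \- L.
apply: (@shift_invariant_eq0 K h (pchar_num K)) => {}p; rewrite /h /=.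
have := bernoulli_affine_shift p 0 (-1); have := bernoulli_affine_shift p 0 1.
rewrite affine_id comp_polyXr -comp_polyA comp_affine !add0r !mul1r subrr => -> ->.
by rewrite mulN1r; ring.
Qed.

(** Replacing p by p(X+1) changes the left side by L(p(2X+2)) - L(p(2X)) = 2p'(0), and the right
    side by the same amount. *)
Lemma bernoulli_duplication p :
  L (p \Po affine 0 2) + L (p \Po affine 1 2) = 2 * L p.
Proof.
apply/eqP; rewrite -subr_eq0; apply/eqP.
pose h : {linear {poly K} -> K^o} :=
  (L \o comp_poly (affine 0 2)) \+ (L \o comp_poly (affine 1 2)) \-
  (2 \*: L).
apply: (@shift_invariant_eq0 K h (pchar_num K)) => {}p; rewrite /h /=.
have := bernoulli_affine_shift p 0 2; have := bernoulli_affine_shift p 0 1.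
rewrite affine_id comp_polyXr -!comp_polyA !comp_affine.
rewrite !add0r !mulr0 !mul1r !addr0.
rewrite /GRing.scale /= => -> E.
have -> : 1 + 1 = 2 :> K by [].
by rewrite E; ring.
Qed.

(** Reflection turns X^i into -(X+1)^i, while L((X+1)^i) = B_i because the derivative of X^i
    vanishes at 0; hence B_i = -B_i. *)
Lemma bernoulli_odd i : odd i -> (i != 1)%N -> bern i = 0.
Proof.
move=> odd_i i1; have := bernoulli_reflection 'X^i.
have := bernoulli_shift 'X^i.
rewrite !comp_Xn_poly umbralXn derivXn hornerMn hornerXn.
have -> : affine (-1) (-1) = (-1) *: affine 1 1 :> {poly K}.
  by rewrite /affine scalerDr scalerA mulr1 polyC1 alg_polyC.
rewrite exprZn -signr_odd odd_i expr1 scaleN1r.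
have -> : L (- affine 1 1 ^+ i) = - L (affine 1 1 ^+ i) by exact: linearN.
have -> : (0 : K) ^+ i.-1 *+ i = 0.
  by case: i odd_i i1 => [|[|i]] // _ _; rewrite expr0n mul0rn.
move=> /subr0_eq -> /eqP.
by rewrite eq_sym -addr_eq0 -mulr2n mulrn_eq0 /= => /eqP.
Qed.

Lemma bernoulli_1 : bern 1 = - 2^-1.
Proof.
have := sum_bernoulli 2; rewrite !big_ord_recr big_ord0 /= add0r.
have := sum_bernoulli 1; rewrite big_ord1 /= mul1r => ->.
rewrite bin1 addrC => /addr0_eq E.
have -> : bernoulli 1 = - 2^-1.
  by apply: (mulfI (_ : 2 != 0)); rewrite // -[LHS]opprK E; field.
by rewrite rmorphN fmorphV /= ratr_nat.
Qed.

(** With d^2 = 144x^2(9x^2-1), the mean of its values at y = (3x+s)^2 and y = (3x-s)^2 is the sum of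
    the theorem. *)
Definition even_part (n : nat) (d y : K) : K :=
  \sum_(0 <= k < (n %/ 2).+1)
     'C(n, 2 * k)%:R * (4 ^+ k - 1) * d ^+ (2 * k) * bern (2 * k)
     * y ^+ (n - 2 * k).

Lemma even_partE n d y :
  even_part n d y = L (affine y (2 * d) ^+ n) - L (affine y d ^+ n)
                    + n%:R * d * y ^+ n.-1 / 2.
Proof.
(* Adding 1/2 to B_1 = -1/2 kills the i = 1 term, so [F] vanishes at every odd index; this
   correction is the last term of the statement. *)
pose F i : K := 'C(n, i)%:R * (2 ^+ i - 1) * d ^+ i *
  (bern i + (i == 1)%N%:R / 2) * y ^+ (n - i).
have F0 i : odd i -> F i = 0.
  rewrite /F => odd_i; have [->|i1] := eqVneq i 1%N.
    by rewrite bernoulli_1 mul1r addNr mulr0 mul0r.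
  by rewrite bernoulli_odd // mul0r addr0 mulr0 mul0r.
have := sum_even n F0; rewrite /even_part => sumE.
transitivity (\sum_(i < n.+1) F i).
  rewrite sumE; apply: eq_bigr => k _; rewrite /F.
  have -> : 2 ^+ (2 * k) = 4 ^+ k :> K by rewrite exprM -natrX.
  have -> : (2 * k == 1)%N = false by rewrite muln_eq1.
  by rewrite mul0r addr0.
rewrite !umbral_binomial -sumrB.
have -> : n%:R * d * y ^+ n.-1 / 2 = \sum_(i < n.+1)
    'C(n, i)%:R * (2 ^+ i - 1) * d ^+ i * ((i == 1 :> nat)%:R / 2)
    * y ^+ (n - i).
  case: n {F F0 sumE} => [|n].
    by rewrite big_ord1 /= !mul0r mulr0 mul0r.
  rewrite 2!big_ord_recl /= big1 ?addr0 => [|i _].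
    by rewrite mul0r mulr0 mul0r add0r bin1 subSS subn0; ring.
  by rewrite /= mul0r mulr0 mul0r.
by rewrite -big_split; apply: eq_bigr => i _; rewrite /F /= exprMn; ring.
Qed.

Lemma even_partD n d y :
  even_part n d (y + d) + even_part n d y =
  n%:R * d * ((y + d) ^+ n.-1 - y ^+ n.-1) / 2.
Proof.
have dup : L (affine (y + d) (2 * d) ^+ n) + L (affine y (2 * d) ^+ n)
   = 2 * L (affine y d ^+ n).
  (* Duplication is applied to p = (y+dX)^n, where p(2X+1) = (y+d+2dX)^n. *)
  rewrite -bernoulli_duplication addrC !rmorphXn /= !comp_affine.
  by rewrite !mulr0 !addr0 !mulr1 (mulrC d).
have := bernoulli_affine_shift 'X^n y d.
rewrite !comp_Xn_poly derivXn hornerMn hornerXn -[_ *+ n]mulr_natl.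
move=> shift.
rewrite !even_partE shift.
transitivity (L (affine (y + d) (2 * d) ^+ n) + L (affine y (2 * d) ^+ n)
  - L (affine y d ^+ n) - (L (affine y d ^+ n) + d * (n%:R * y ^+ n.-1))
  + n%:R * d * (y + d) ^+ n.-1 / 2 + n%:R * d * y ^+ n.-1 / 2); first ring.
by rewrite dup; field.
Qed.

(** * Binet formulas *)

Lemma balancing_char_root (x s : K) m : s ^+ 2 = 9 * x ^+ 2 - 1 ->
  (3 * x + s) ^+ m.+2 = 6 * x * (3 * x + s) ^+ m.+1 - (3 * x + s) ^+ m.
Proof.
(* 3x+s is a root of t^2 - 6xt + 1; the conjugate root is covered by replacing s with -s. *)
move=> sE; rewrite -[m.+2]addn2 exprD sqrrD sE (exprS _ m).
by move: ((_ + s) ^+ m) => t; ring.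
Qed.

Lemma lucas_balancingE (x s : K) m : s ^+ 2 = 9 * x ^+ 2 - 1 ->
  (lucas_balancing K m).[x] = ((3 * x + s) ^+ m + (3 * x - s) ^+ m) / 2.
Proof.
move=> sE; elim/ltn_ind: m => -[|[|m]] IHm.
- by rewrite /= hornerE !expr0; field.
- by rewrite /= !hornerE /=; field.
have -> : lucas_balancing K m.+2 =
  6%:R *: 'X * lucas_balancing K m.+1 - lucas_balancing K m by [].
by rewrite !hornerE !IHm // !balancing_char_root ?sqrrN //=; field.
Qed.

(** Keeping 2s as a factor instead of dividing by it includes the case s = 0. *)
Lemma balancingE (x s : K) m : s ^+ 2 = 9 * x ^+ 2 - 1 ->
  2 * s * (balancing K m).[x] = (3 * x + s) ^+ m - (3 * x - s) ^+ m.
Proof.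
move=> sE; elim/ltn_ind: m => -[|[|m]] IHm.
- by rewrite /= hornerE !expr0; ring.
- by rewrite /= !hornerE /=; ring.
have -> : balancing K m.+2 =
  6%:R *: 'X * balancing K m.+1 - balancing K m by [].
by rewrite !hornerE mulrBr mulrCA !IHm // !balancing_char_root ?sqrrN //=; ring.
Qed.

End BernoulliFunctional.

Theorem theorem8 (R : realType) (n : nat) (x : R[i]) :
  \sum_(0 <= k < (n %/ 2).+1)
     'C(n, 2 * k)%:R * (4 ^+ k - 1) * (144 * x ^+ 2 * (9 * x ^+ 2 - 1)) ^+ k
     * ratr (bernoulli (2 * k)) * (lucas_balancing R[i] (2 * (n - 2 * k))).[x]
  = 6 * n%:R * x * (9 * x ^+ 2 - 1) * (balancing R[i] (2 * (n - 1))).[x].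
Proof.
pose s := sqrtC (9 * x ^+ 2 - 1).
have sE : s ^+ 2 = 9 * x ^+ 2 - 1 by rewrite sqrtCK.
pose d := 12 * x * s; pose y := (3 * x - s) ^+ 2.
have ydE : y + d = (3 * x + s) ^+ 2 by rewrite /y /d; ring.
transitivity ((even_part n d (y + d) + even_part n d y) / 2).
  rewrite /even_part -big_split mulr_suml; apply: eq_bigr => k _ /=.
  rewrite (lucas_balancingE _ sE) -sE ydE /y -!exprM.
  have -> : d ^+ (2 * k) = (144 * x ^+ 2 * s ^+ 2) ^+ k.
    by rewrite exprM; congr (_ ^+ k); rewrite /d; ring.
  by field.
(* The s in d = 12xs meets the 2s of [balancingE], which produces s^2 = 9x^2-1. For n = 0 the factor
   n makes the truncated n - 1 harmless. *)
rewrite even_partD ydE /y -!exprM -subn1 -(balancingE _ sE) -sE /d.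
by field.
Qed.
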